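(* Let $\underline{Q}$ be a lower transition rate operator on $\mathcal{L}(\mathcal{X})$, and let $f\in\mathcal{L}(\mathcal{X})$, $m,n\in\mathbb{N}$ and $\delta\in\mathbb{R}_{>0}$ with $\delta\|\underline{Q}\|<2$. Put $t:=n\delta$ and $k:=\lceil n/m\rceil$. If $\beta:=\rho((I+\delta\underline{Q})^m)<1$, then $$\|\underline{T}_tf-\Psi_t(n)f\|\leq\epsilon_e:=m\delta^2\|\underline{Q}\|^2\|f\|_c\,\frac{1-\beta^k}{1-\beta}\leq\epsilon_d:=\frac{m\delta^2\|\underline{Q}\|^2\|f\|_c}{1-\beta}.$$ The same is true for $\beta=\rho(\underline{T}_{m\delta})$ (that is, if $\beta:=\rho(\underline{T}_{m\delta})<1$, then the same inequalities hold with this $\beta$).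
   Context: $\mathcal{X}$ is a non-empty finite set and $\mathcal{L}(\mathcal{X})$ is the vector space of real-valued functions on $\mathcal{X}$; real numbers are identified with constant functions and inequalities between functions are pointwise. $\|f\|:=\max_{x}|f(x)|$, $\|f\|_v:=\max f-\min f$, $\|f\|_c:=\|f\|_v/2$. $\mathbb{I}_x$ is the indicator function of $\{x\}$, and $I$ is the identity operator. The norm of a non-negatively homogeneous operator $A$ on $\mathcal{L}(\mathcal{X})$ (i.e. $A(\mu f)=\mu Af$ for $\mu\ge0$) is $\|A\|:=\sup\{\|Af\|: \|f\|=1\}$. $\mathbb{N}=\{1,2,\dots\}$. A lower transition rate operator is a map $\underline{Q}:\mathcal{L}(\mathcal{X})\to\mathcal{L}(\mathcal{X})$ such that for all $f,g\in\mathcal{L}(\mathcal{X})$, $\mu\geq 0$, $\gamma\in\mathbb{R}$ and $x\neq y$ in $\mathcal{X}$: $\underline{Q}\gamma=0$; $\underline{Q}(f+g)\geq\underline{Q}f+\underline{Q}g$; $\underline{Q}(\mu f)=\mu\underline{Q}f$; $[\underline{Q}\mathbb{I}_x](y)\geq 0$. For such $\underline{Q}$ and $f\in\mathcal{L}(\mathcal{X})$, $t\mapsto\underline{T}_tf$ denotes the unique solution on $\mathbb{R}_{\ge0}$ of $\frac{\mathrm d}{\mathrm dt}\underline{T}_tf=\underline{Q}\,\underline{T}_tf$ with $\underline{T}_0f=f$ (existence and uniqueness are known). $\Psi_t(n):=(I+\frac tn\underline{Q})^n$. A lower transition operator is an operator $\underline{T}$ on $\mathcal{L}(\mathcal{X})$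 with $\underline{T}f\ge\min f$, $\underline{T}(f+g)\ge\underline{T}f+\underline{T}g$ and $\underline{T}(\mu f)=\mu\underline{T}f$ for all $f,g\in\mathcal{L}(\mathcal{X})$ and $\mu\ge0$; both $\underline{T}_s$ ($s\ge0$) and $(I+\delta\underline{Q})^m$ (for $\delta\|\underline{Q}\|\le2$) are lower transition operators. The coefficient of ergodicity of a lower transition operator is $\rho(\underline{T}):=\max\{\|\underline{T}f\|_v: f\in\mathcal{L}(\mathcal{X}),\ 0\leq f\leq1\}$. *)

(* Defs.v *)
From HB Require Import structures.
From mathcomp Require Import all_boot all_order all_algebra.
From mathcomp Require Import all_classical all_reals all_analysis.
Import Order.TTheory GRing.Theory Num.Theory.
Import numFieldNormedType.Exports.

Set Implicit Arguments.
Unset Strict Implicit.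
Unset Printing Implicit Defensive.

Local Open Scope classical_set_scope.
Local Open Scope ring_scope.

(* L(X) is [{ffun X -> R}]; an operator on L(X) is an arbitrary function
   [{ffun X -> R} -> {ffun X -> R}], in general not linear. *)

(* The range of [f] is finite, so for non-empty [X] these are a maximum and a
   minimum. *)
Definition fmax (R : realType) (X : finType) (f : {ffun X -> R}) : R :=
  sup (range f).
Definition fmin (R : realType) (X : finType) (f : {ffun X -> R}) : R :=
  inf (range f).

Definition fnorm (R : realType) (X : finType) (f : {ffun X -> R}) : R :=
  fmax [ffun x => `|f x|].

Definition fnorm_v (R : realType) (X : finType) (f : {ffun X -> R}) : R :=
  fmax f - fmin f.

Definition fnorm_c (R : realType) (X : finType) (f : {ffun X -> R}) : R :=
  fnorm_v f / 2.

Definition findic (R : realType) (X : finType) (x : X) : {ffun X -> R} :=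
  [ffun y => (y == x)%:R].

(* [sup] is 0 on a set without upper bound; here the set is bounded whenever
   [A] is a lower transition rate operator. *)
Definition opnorm (R : realType) (X : finType)
    (A : {ffun X -> R} -> {ffun X -> R}) : R :=
  sup [set fnorm (A f) | f in [set f : {ffun X -> R} | fnorm f = 1]].

Record lower_transition_rate_operator (R : realType) (X : finType)
    (Q : {ffun X -> R} -> {ffun X -> R}) : Prop := {
  ltro_cst : forall gamma : R, Q [ffun=> gamma] = [ffun=> 0] ;
  ltro_superadd : forall (f g : {ffun X -> R}) (x : X),
    Q f x + Q g x <= Q (f + g) x ;
  ltro_homog : forall (mu : R) (f : {ffun X -> R}),
    0 <= mu -> Q (mu *: f) = mu *: Q f ;
  ltro_indic : forall x y : X, x != y -> 0 <= Q (findic R x) y }.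

(* u' = Q u on [0, +oo[ with u 0 = f, the derivative being taken in the normed
   space (L(X), fnorm) and, through the [within], one-sided at t = 0.  The
   values of [u] at negative times are irrelevant. *)
Definition solves_rate_ode (R : realType) (X : finType)
    (Q : {ffun X -> R} -> {ffun X -> R}) (f : {ffun X -> R})
    (u : R -> {ffun X -> R}) : Prop :=
  u 0 = f /\
  forall t : R, 0 <= t ->
    fnorm (h^-1 *: (u (t + h) - u t) - Q (u t))
      @[h --> within [set h : R | 0 <= t + h] (0 : R)^'] --> (0 : R).

(* I + delta Q *)
Definition euler_step (R : realType) (X : finType)
    (Q : {ffun X -> R} -> {ffun X -> R}) (delta : R) (f : {ffun X -> R}) :
    {ffun X -> R} :=
  f + delta *: Q f.

Definition Psi (R : realType) (X : finType)
    (Q : {ffun X -> R} -> {ffun X -> R}) (t : R) (n : nat) :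
    {ffun X -> R} -> {ffun X -> R} :=
  iter n (euler_step Q (t / n%:R)).

(* For a lower transition operator [T] this set is contained in [0, 1] and its
   supremum is attained, since [T] is continuous. *)
Definition ergodicity_coef (R : realType) (X : finType)
    (T : {ffun X -> R} -> {ffun X -> R}) : R :=
  sup [set fnorm_v (T f) |
        f in [set f : {ffun X -> R} | forall x, 0 <= f x <= 1]].

(* Main.v *)
(* Write E = I + delta Q and let q be the norm of Q.  Since Q is q-Lipschitz
   and invariant under adding constants, the mean value theorem applied to each
   coordinate of a solution u of u' = Q u gives
     fnorm (u b - (I + (b - a) Q) (u a)) <= (b - a)^2 q^2 C
   as soon as fnorm_c u <= C on [a, b].  With a crude C (continuity of u) and
   the nonexpansiveness of Euler steps, Euler's scheme converges to u; hence
   solutions are unique, T is a semigroup, and each T t is a lower transition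
   operator as a limit of such.  This yields the sharp one-step error
     fnorm (T delta g - E g) <= delta^2 q^2 fnorm_c g.
   For nonexpansive A, a telescoping sum bounds fnorm (A^n f - B^n f) by the sum
   of the one-step errors at the points B^i f, and fnorm_c (B^i f) decays like
   beta^(i / m) with beta the coefficient of ergodicity of B^m.  The two claims
   are the cases (A, B) = (T delta, E) and (A, B) = (E, T delta). *)
Require Import Defs.
From mathcomp Require Import all_boot all_order all_algebra.
From mathcomp Require Import all_classical all_reals all_analysis.
From mathcomp Require Import ring lra.
Import Order.TTheory GRing.Theory Num.Theory.
Import numFieldNormedType.Exports.
Set Implicit Arguments.
Unset Strict Implicit.
Unset Printing Implicit Defensive.
Local Open Scope classical_set_scope.
Local Open Scope ring_scope.

(** * Suprema, infima and the two seminorms on functions over a finite set *)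

Section FunctionNorms.
Context {R : realType} {X : finType}.
Implicit Types (f g : {ffun X -> R}) (c : R) (x : X).

Lemma scale_ffunEr c f x : (c *: f) x = c * f x.
Proof. by rewrite ffunE. Qed.

Lemma range_ubound f : has_ubound (range f).
Proof.
exists (\sum_x `|f x|) => _ [x _ <-].
by rewrite (bigD1 x) //= (le_trans (ler_norm _)) // lerDl sumr_ge0.
Qed.

Lemma range_lbound f : has_lbound (range f).
Proof.
exists (- \sum_x `|f x|) => _ [x _ <-].
by rewrite (bigD1 x) //= lerNl (le_trans (ler_norm _)) // normrN lerDl sumr_ge0.
Qed.

Lemma le_fmax f x : f x <= fmax f.
Proof. by apply: ub_le_sup; [exact: range_ubound | exists x]. Qed.

Lemma fmin_le f x : fmin f <= f x.
Proof. by apply: ge_inf; [exact: range_lbound | exists x]. Qed.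

Lemma fnorm_ge f x : `|f x| <= fnorm f.
Proof. by have := le_fmax [ffun y => `|f y|] x; rewrite ffunE. Qed.

Section NonEmpty.
Context (x0 : X).

Lemma fmax_le f c : (forall x, f x <= c) -> fmax f <= c.
Proof. by move=> fc; apply: ge_sup => [|_ [x _ <-]]; [exists (f x0), x0|]. Qed.

Lemma le_fmin f c : (forall x, c <= f x) -> c <= fmin f.
Proof. by move=> fc; apply: lb_le_inf => [|_ [x _ <-]]; [exists (f x0), x0|]. Qed.

Lemma fnorm_le f c : (forall x, `|f x| <= c) -> fnorm f <= c.
Proof. by move=> fc; apply: fmax_le => x; rewrite ffunE. Qed.

Lemma fnorm_ge0 f : 0 <= fnorm f.
Proof. exact: le_trans (fnorm_ge f x0). Qed.

Lemma fnorm_v_ge0 f : 0 <= fnorm_v f.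
Proof. by rewrite subr_ge0 (le_trans (fmin_le f x0)) ?le_fmax. Qed.

Lemma fnorm_c_ge0 f : 0 <= fnorm_c f.
Proof. by rewrite divr_ge0 ?fnorm_v_ge0. Qed.

Lemma fnormD f g : fnorm (f + g) <= fnorm f + fnorm g.
Proof.
apply: fnorm_le => x; rewrite ffunE (le_trans (ler_normD _ _)) //.
by rewrite lerD ?fnorm_ge.
Qed.

Lemma fnormN f : fnorm (- f) = fnorm f.
Proof. by congr fmax; apply/ffunP => x; rewrite !ffunE normrN. Qed.

Lemma fnormZ c f : fnorm (c *: f) = `|c| * fnorm f.
Proof.
apply/eqP; rewrite eq_le; apply/andP; split.
  by apply: fnorm_le => x; rewrite ffunE normrM ler_wpM2l ?fnorm_ge.
have [->|c0] := eqVneq c 0; first by rewrite normr0 mul0r fnorm_ge0.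
rewrite mulrC -ler_pdivlMr ?normr_gt0 //; apply: fnorm_le => x.
rewrite ler_pdivlMr ?normr_gt0 // mulrC -normrM.
by apply: le_trans (fnorm_ge _ x); rewrite ffunE.
Qed.

Lemma fnorm_cst c : fnorm ([ffun=> c] : {ffun X -> R}) = `|c|.
Proof.
apply/eqP; rewrite eq_le; apply/andP; split.
  by apply: fnorm_le => x; rewrite ffunE.
by apply: le_trans (fnorm_ge _ x0); rewrite ffunE.
Qed.

Lemma fnorm0 : fnorm (0 : {ffun X -> R}) = 0.
Proof. by rewrite -[0]/([ffun=> 0]) fnorm_cst normr0. Qed.

Lemma fnorm_eq0 f : fnorm f = 0 -> f = 0.
Proof.
move=> f0; apply/ffunP => x; apply/eqP; rewrite ffunE -normr_eq0 eq_le normr_ge0.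
by rewrite -f0 fnorm_ge.
Qed.

Lemma fnorm_v_le f a b : (forall x, a <= f x <= b) -> fnorm_v f <= b - a.
Proof.
by move=> fab; apply: lerB; [apply: fmax_le|apply: le_fmin] => x;
  have /andP[] := fab x.
Qed.

Lemma fnorm_c_le_fnorm f : fnorm_c f <= fnorm f.
Proof.
rewrite ler_pdivrMr // (le_trans (@fnorm_v_le f (- fnorm f) (fnorm f) _)) //.
  by move=> x; rewrite -ler_norml fnorm_ge.
by rewrite opprK mulrDr mulr1.
Qed.

(** Subtracting the midpoint of the range centres it at 0. For operators that ignore constants, this
    turns bounds in [fnorm] into bounds in [fnorm_c]. *)
Lemma fnorm_center f : exists c, fnorm (f + [ffun=> c]) <= fnorm_c f.
Proof.
exists (- ((fmax f + fmin f) / 2)); apply: fnorm_le => x.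
rewrite !ffunE ler_norml /fnorm_c /fnorm_v.
by have := fmin_le f x; have := le_fmax f x; lra.
Qed.

End NonEmpty.
End FunctionNorms.

(** The class that contains both the Euler steps and the operators [T t], so that the error analysis
    of iterates can be applied with either one in either role. *)
Record lower_transition_operator (R : realType) (X : finType)
    (L : {ffun X -> R} -> {ffun X -> R}) : Prop := {
  lto_min : forall (f : {ffun X -> R}) (x : X), fmin f <= L f x ;
  lto_superadd : forall (f g : {ffun X -> R}) (x : X),
    L f x + L g x <= L (f + g) x ;
  lto_homog : forall (mu : R) (f : {ffun X -> R}),
    0 <= mu -> L (mu *: f) = mu *: L f }.

(** * Nonexpansiveness and contraction of lower transition operators *)

Section LowerTransitionOperators.
Context {R : realType} {X : finType} (x0 : X).
Implicit Types (f g : {ffun X -> R}) (c : R) (x : X)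
  (L M : {ffun X -> R} -> {ffun X -> R}).

Lemma lto_conj L f x : lower_transition_operator L -> L f x <= - L (- f) x.
Proof.
move=> Lt; have := lto_superadd Lt f (- f) x; rewrite subrr.
have -> : L 0 = 0 by rewrite -(scale0r (0 : {ffun X -> R})) lto_homog // !scale0r.
by rewrite ffunE; lra.
Qed.

Lemma lto_max L f x : lower_transition_operator L -> L f x <= fmax f.
Proof.
move=> Lt; rewrite (le_trans (lto_conj f x Lt)) // lerNl.
apply: le_trans (lto_min Lt _ _); apply: (le_fmin x0) => y.
by rewrite ffunE lerN2 le_fmax.
Qed.

Lemma lto_addcst L f c : lower_transition_operator L ->
  L (f + [ffun=> c]) = L f + [ffun=> c].
Proof.
move=> Lt.
have Lc b x : b <= L [ffun=> b] x.
  by apply: le_trans (lto_min Lt _ _); apply: (le_fmin x0) => y; rewrite ffunE.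
apply/ffunP => x; apply/eqP; rewrite eq_le; apply/andP; split.
  (* Superadditivity alone gives only one inequality; the other follows by adding the constant [- c]
     back to [f + c]. *)
  have := lto_superadd Lt (f + [ffun=> c]) [ffun=> - c] x.
  have -> : f + [ffun=> c] + [ffun=> - c] = f.
    by apply/ffunP => y; rewrite !ffunE addrK.
  by rewrite [(L f + _) x]ffunE ffunE; have := Lc (- c) x; lra.
have := lto_superadd Lt f [ffun=> c] x; have := Lc c x.
by rewrite [(L f + [ffun=> c]) x]ffunE [[ffun=> c] x]ffunE; lra.
Qed.

Lemma lto_monotone L f g x : lower_transition_operator L ->
  (forall y, f y <= g y) -> L f x <= L g x.
Proof.
move=> Lt fg; have := lto_superadd Lt f (g - f) x; rewrite subrKC.
suff : 0 <= L (g - f) x by lra.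
apply: le_trans (lto_min Lt _ _); apply: (le_fmin x0) => y.
by rewrite !ffunE subr_ge0.
Qed.

(** Superadditivity gives [L a - L b >= L (a - b) >= fmin (a - b)]; exchanging [a] and [b] gives the
    other side. *)
Lemma lto_nonexpansive L f g : lower_transition_operator L ->
  fnorm (L f - L g) <= fnorm (f - g).
Proof.
move=> Lt.
have D a b x : L a x - L b x >= - fnorm (a - b).
  have := lto_superadd Lt b (a - b) x; rewrite subrKC.
  suff : - fnorm (a - b) <= L (a - b) x by lra.
  apply: le_trans (lto_min Lt _ _); apply: (le_fmin x0) => y.
  by have := fnorm_ge (a - b) y; rewrite ler_norml => /andP[].
apply: (fnorm_le x0) => x; rewrite !ffunE ler_norml D /= -lerN2 opprB.
by rewrite -fnormN opprB D.
Qed.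

Lemma lto_fnorm_v L f : lower_transition_operator L ->
  fnorm_v (L f) <= fnorm_v f.
Proof.
by move=> Lt; apply: (fnorm_v_le x0) => x; rewrite lto_min ?lto_max.
Qed.

Lemma lto_comp L M : lower_transition_operator L ->
  lower_transition_operator M -> lower_transition_operator (L \o M).
Proof.
move=> Lt Mt; split=> [f x|f g x|mu f mu0] /=.
- by apply: le_trans (lto_min Lt _ _); apply: (le_fmin x0) => y; exact: lto_min.
- apply: le_trans (lto_superadd Lt _ _ _) _; apply: lto_monotone => // y.
  by rewrite ffunE lto_superadd.
- by rewrite !lto_homog.
Qed.

Lemma lto_iter L n : lower_transition_operator L ->
  lower_transition_operator (iter n L).
Proof.
move=> Lt; elim: n => [|n IHn]; last exact: lto_comp.
by split=> //= f => [x|g x]; [exact: fmin_le|rewrite ffunE].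
Qed.

(** Needed for the supremum in [ergodicity_coef] to bound its elements rather than be the default
    value 0. *)
Lemma ergodicity_set_ubound L : lower_transition_operator L ->
  has_ubound [set fnorm_v (L f) |
    f in [set f : {ffun X -> R} | forall x, 0 <= f x <= 1]].
Proof.
move=> Lt; exists 1 => _ [f f01 <-]; rewrite (le_trans (lto_fnorm_v f Lt)) //.
by rewrite (le_trans (fnorm_v_le x0 f01)) ?subr0.
Qed.

Lemma ergodicity_coef_ge0 L : lower_transition_operator L ->
  0 <= ergodicity_coef L.
Proof.
move=> Lt; apply: le_trans (fnorm_v_ge0 x0 (L 0)) _; apply: ub_le_sup.
  exact: ergodicity_set_ubound.
by exists 0 => //= x; rewrite ffunE lexx ler01.
Qed.

Lemma fnorm_v_scale_shift (a c : R) f : 0 <= a ->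
  fnorm_v (a *: f + [ffun=> c]) <= a * fnorm_v f.
Proof.
move=> a0; apply: le_trans (fnorm_v_le x0 (_ : forall x,
  a * fmin f + c <= _ <= a * fmax f + c)) _; last by rewrite /fnorm_v; lra.
by move=> x; rewrite ffunE scale_ffunEr ffunE !lerD2r !ler_wpM2l ?fmin_le ?le_fmax.
Qed.

Lemma lto_contraction L f : lower_transition_operator L ->
  fnorm_v (L f) <= ergodicity_coef L * fnorm_v f.
Proof.
move=> Lt; have v0 := fnorm_v_ge0 x0 f.
have [fv0|fv_neq0] := eqVneq (fnorm_v f) 0.
  by rewrite fv0 mulr0 -fv0 lto_fnorm_v.
(* A non-constant [f] is rescaled to a function with values in [0, 1], to which the definition of
   the coefficient applies. *)
pose g := (fnorm_v f)^-1 *: (f + [ffun=> - fmin f]).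
have {1}-> : f = fnorm_v f *: g + [ffun=> fmin f].
  by apply/ffunP => x; rewrite /g scalerA divff // scale1r !ffunE subrK.
rewrite lto_addcst // lto_homog // (le_trans (fnorm_v_scale_shift _ _ v0)) //.
rewrite mulrC ler_wpM2r //; apply: ub_le_sup; first exact: ergodicity_set_ubound.
exists g => //= x; rewrite /g scale_ffunEr !ffunE mulrC; apply/andP; split.
  by rewrite divr_ge0 // subr_ge0 fmin_le.
by rewrite ler_pdivrMr ?lt_def ?fv_neq0 // mul1r lerD2r le_fmax.
Qed.

End LowerTransitionOperators.

(** * Boundedness and Lipschitz continuity of rate operators; Euler steps as lower transition
    operators *)

Section LowerTransitionRateOperators.
Context {R : realType} {X : finType} (x0 : X).
Context (Q : {ffun X -> R} -> {ffun X -> R}).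
Context (Qr : lower_transition_rate_operator Q).
Implicit Types (f g : {ffun X -> R}) (c : R) (x : X).

Lemma ltro_shift f c : Q (f + [ffun=> c]) = Q f.
Proof.
have le a b x : Q a x <= Q (a + [ffun=> b]) x.
  by have := ltro_superadd Qr a [ffun=> b] x; rewrite ltro_cst //;
    rewrite [X in _ + X]ffunE addr0.
apply/ffunP => x; apply/eqP; rewrite eq_le le andbT.
apply: le_trans (le _ (- c) _) _; rewrite -addrA.
rewrite [X in f + X](_ : _ = 0) ?addr0 //.
by apply/ffunP => y; rewrite !ffunE subrr.
Qed.

Lemma ltro0 : Q 0 = 0.
Proof. exact: (ltro_cst Qr 0). Qed.

Lemma ltro_conj f x : Q f x <= - Q (- f) x.
Proof. by have := ltro_superadd Qr f (- f) x; rewrite subrr ltro0 ffunE; lra. Qed.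

(** A nonnegative function is a nonnegative combination of indicators, over which superadditivity
    and homogeneity distribute [Q]. *)
Lemma ltro_sum_indic f x : (forall y, 0 <= f y) ->
  \sum_y f y * Q (findic R y) x <= Q f x.
Proof.
move=> f0.
have {2}-> : f = \sum_y f y *: findic R y.
  apply/ffunP => z; rewrite sum_ffunE (bigD1 z) //= big1 => [|y yz].
    by rewrite scale_ffunEr ffunE eqxx mulr1 addr0.
  by rewrite scale_ffunEr ffunE eq_sym (negPf yz) mulr0.
elim/big_ind2: _ => [|a g b h ag bh|y _].
- by rewrite ltro0 ffunE.
- by apply: le_trans (ltro_superadd Qr _ _ _); exact: lerD.
- by rewrite ltro_homog // scale_ffunEr.
Qed.

Lemma opnorm_set_ubound :
  has_ubound [set fnorm (Q f) | f in [set f : {ffun X -> R} | fnorm f = 1]].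
Proof.
(* The factor 2 arises because [fnorm f = 1] gives [0 <= f + 1 <= 2], and [Q] does not see the added
   1. The upper bound on [Q f] then comes from the lower bound for [- f]. *)
pose B := 2 * \sum_x \sum_y `|Q (findic R y) x|.
have lb f x : fnorm f = 1 -> - B <= Q f x.
  move=> f1; rewrite -(ltro_shift f 1).
  have fb y : `|f y| <= 1 by rewrite -f1 fnorm_ge.
  apply: le_trans (ltro_sum_indic x _); last first.
    by move=> y; rewrite !ffunE; have := fb y; rewrite ler_norml; lra.
  rewrite lerNl -sumrN /B [X in _ * X](bigD1 x) //= mulrDr mulr_sumr.
  rewrite -[leLHS]addr0 lerD ?mulr_ge0 ?sumr_ge0 // => [|z _]; last exact: sumr_ge0.
  apply: ler_sum => y _; apply: le_trans (ler_norm _) _.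
  rewrite normrN normrM ler_wpM2r // !ffunE.
  by have := fb y; rewrite !ler_norml; lra.
exists B => _ [f f1 <-]; apply: (fnorm_le x0) => x; rewrite ler_norml lb //=.
by apply: le_trans (ltro_conj _ _) _; rewrite lerNl lb ?fnormN.
Qed.

Lemma ltro_bounded f : fnorm (Q f) <= opnorm Q * fnorm f.
Proof.
have [/(fnorm_eq0 (f := f)) ->|f_neq0] := eqVneq (fnorm f) 0.
  by rewrite ltro0 (fnorm0 x0) mulr0.
have f_gt0 : 0 < fnorm f by rewrite lt_def f_neq0 fnorm_ge0.
rewrite -ler_pdivrMr // mulrC.
have := fnormZ x0 (fnorm f)^-1 (Q f).
rewrite normfV (ger0_norm (ltW f_gt0)) => <-.
rewrite -(ltro_homog Qr) ?invr_ge0 ?fnorm_ge0 //; apply: ub_le_sup.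
  exact: opnorm_set_ubound.
exists ((fnorm f)^-1 *: f) => //=.
by rewrite fnormZ // normfV (ger0_norm (ltW f_gt0)) mulVf.
Qed.

Lemma opnorm_ge0 : 0 <= opnorm Q.
Proof.
have := ltro_bounded [ffun=> 1]; rewrite (fnorm_cst x0) normr1 mulr1.
exact: le_trans (fnorm_ge0 x0 _).
Qed.

Lemma ltro_bounded_c f : fnorm (Q f) <= opnorm Q * fnorm_c f.
Proof.
have [c fc] := fnorm_center x0 f.
rewrite -(ltro_shift f c) (le_trans (ltro_bounded _)) //.
by rewrite ler_wpM2l ?opnorm_ge0.
Qed.

Lemma ltro_lipschitz f g : fnorm (Q f - Q g) <= opnorm Q * fnorm (f - g).
Proof.
have D a b x : - (opnorm Q * fnorm (a - b)) <= Q a x - Q b x.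
  have := ltro_superadd Qr b (a - b) x; rewrite subrKC.
  have := le_trans (fnorm_ge _ x) (ltro_bounded (a - b)).
  by rewrite ler_norml => /andP[]; lra.
apply: (fnorm_le x0) => x; rewrite !ffunE ler_norml D /= -lerN2 opprB.
by rewrite -fnormN opprB D.
Qed.

(** Shifting the indicator by -1/2 halves its norm without changing its image. This gain of a factor
    2 is why steps with [d * opnorm Q <= 2] are admissible. *)
Lemma ltro_indic_diag x : - (opnorm Q / 2) <= Q (findic R x) x.
Proof.
rewrite -(ltro_shift _ (- 2^-1)).
set f := (_ + _); suff f2 : fnorm f <= 2^-1.
  have := le_trans (fnorm_ge _ x) (ltro_bounded f).
  rewrite ler_norml => /andP[+ _]; apply: le_trans.
  by rewrite lerN2 ler_wpM2l ?opnorm_ge0.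
apply: (fnorm_le x0) => y; rewrite !ffunE ler_norml.
by case: (y == x) => /=; lra.
Qed.

Lemma euler_step_lto d : 0 <= d -> d * opnorm Q <= 2 ->
  lower_transition_operator (euler_step Q d).
Proof.
move=> d0 dQ; split=> [f x|f g x|mu f mu0]; rewrite /euler_step.
- suff : 0 <= (f x - fmin f) + d * Q f x by rewrite ffunE scale_ffunEr; lra.
  rewrite -(ltro_shift f (- fmin f)).
  have g0 y : 0 <= (f + [ffun=> - fmin f]) y by rewrite !ffunE subr_ge0 fmin_le.
  (* After the shift by [- fmin f], the expansion over indicators has nonnegative off-diagonal
     terms, so only the diagonal one is kept. *)
  apply: (@le_trans _ _ ((f x - fmin f) * (1 + d * Q (findic R x) x))).
    rewrite mulr_ge0 ?subr_ge0 ?fmin_le //.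
    have := ler_wpM2l d0 (ltro_indic_diag x); lra.
  rewrite mulrDr mulr1 lerD2l mulrCA ler_wpM2l //.
  apply: le_trans (ltro_sum_indic x g0); rewrite (bigD1 x) //= !ffunE lerDl.
  by apply: sumr_ge0 => y yx; rewrite mulr_ge0 ?(ltro_indic Qr).
- rewrite !(scale_ffunEr, ffunE); have := ler_wpM2l d0 (ltro_superadd Qr f g x); lra.
- by rewrite (ltro_homog Qr) // scalerDr !scalerA mulrC.
Qed.

End LowerTransitionRateOperators.

(** * Accumulated error of iterates of two lower transition operators *)

Lemma sum_expr_divn {R : realFieldType} (b : R) (k m n : nat) : 0 <= b < 1 ->
  (0 < m)%N -> (n <= k * m)%N ->
  \sum_(0 <= i < n) b ^+ (i %/ m) <= m%:R * ((1 - b ^+ k) / (1 - b)).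
Proof.
move=> /andP[b0 b1] m0 nkm.
(* Over [k] full blocks of length [m] each power of [b] occurs [m] times, a geometric sum;
   completing the last block only adds nonnegative terms. *)
have -> : m%:R * ((1 - b ^+ k) / (1 - b)) = \sum_(0 <= i < k * m) b ^+ (i %/ m).
  elim: k {nkm} => [|k IHk].
    by rewrite big_geq // expr0 subrr mul0r mulr0.
  rewrite mulSn addnC (@big_cat_nat _ _ _ (k * m)) ?leq_addr //= -IHk.
  rewrite -[X in \sum_(X <= _ < _) _]add0n big_addn addKn.
  rewrite (eq_big_nat _ _ (F2 := fun=> b ^+ k)) => [|i /andP[_ im]].
    rewrite sumr_const_nat subn0 -mulr_natl exprS; field.
    by rewrite subr_eq0 gt_eqF.
  by rewrite addnC divnMDl // divn_small ?addn0.
rewrite (@big_cat_nat _ _ _ n 0 (k * m)) //= lerDl sumr_ge0 // => i _.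
exact: exprn_ge0.
Qed.

Section IterationError.
Context {R : realType} {X : finType} (x0 : X).
Context (A B : {ffun X -> R} -> {ffun X -> R}).
Context (At : lower_transition_operator A) (Bt : lower_transition_operator B).
Implicit Types f : {ffun X -> R}.

Lemma iter_sub_le f n : fnorm (iter n A f - iter n B f) <=
  \sum_(0 <= i < n) fnorm (A (iter i B f) - B (iter i B f)).
Proof.
elim: n => [|n IHn]; first by rewrite subrr big_geq // (fnorm0 x0).
(* Inserting [A (B^n f)] separates the old error, which [A] does not increase, from the new one-step
   error. *)
rewrite big_nat_recr //= -(subrKA (A (iter n B f))).
apply: le_trans (fnormD x0 _ _) _; rewrite lerD2r.
exact: le_trans (lto_nonexpansive x0 _ _ At) IHn.
Qed.

(** Each full block of [m] iterations contracts by the coefficient, and the [i %% m] remaining ones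
    do not increase the seminorm. *)
Lemma fnorm_c_iter f m i : (0 < m)%N ->
  fnorm_c (iter i B f) <= ergodicity_coef (iter m B) ^+ (i %/ m) * fnorm_c f.
Proof.
move=> m0; rewrite mulrA ler_pM2r ?invr_gt0 //.
have Bm := lto_iter x0 m Bt.
rewrite {1}(divn_eq i m) addnC iterD iterM.
apply: le_trans (lto_fnorm_v x0 _ (lto_iter x0 _ Bt)) _.
elim: (i %/ m)%N => [|j IHj]; first by rewrite mul1r.
apply: le_trans (lto_contraction x0 _ Bm) _; rewrite exprS -mulrA.
by rewrite ler_wpM2l ?(ergodicity_coef_ge0 x0 Bm).
Qed.

(** The one-step errors are taken along the orbit of [B], so only the ergodicity of [B] matters;
    exchanging [A] and [B] changes the coefficient but not the left-hand side. *)
Lemma iter_error f (e : R) (k m n : nat) (b := ergodicity_coef (iter m B)) :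
  (forall g, fnorm (A g - B g) <= e * fnorm_c g) -> 0 <= e ->
  (0 < m)%N -> (n <= k * m)%N -> b < 1 ->
  fnorm (iter n A f - iter n B f) <=
    m%:R * e * fnorm_c f * ((1 - b ^+ k) / (1 - b)).
Proof.
move=> ABe e0 m0 nkm b1; apply: le_trans (iter_sub_le f n) _.
have b01 : 0 <= b < 1 by rewrite b1 (ergodicity_coef_ge0 x0 (lto_iter x0 m Bt)).
apply: (@le_trans _ _ (e * fnorm_c f * \sum_(0 <= i < n) b ^+ (i %/ m))).
  rewrite mulr_sumr; apply: ler_sum => i _; apply: le_trans (ABe _) _.
  by rewrite -mulrA ler_wpM2l // mulrC fnorm_c_iter.
rewrite [leRHS](_ : _ = e * fnorm_c f * (m%:R * ((1 - b ^+ k) / (1 - b))));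
  last by ring.
rewrite ler_wpM2l ?mulr_ge0 ?(fnorm_v_ge0 x0) //; exact: sum_expr_divn.
Qed.

End IterationError.

(** * Solutions of the rate equation and convergence of Euler's scheme *)

Section RateEquation.
Context {R : realType} {X : finType} (x0 : X).
Context (Q : {ffun X -> R} -> {ffun X -> R}).
Context (Qr : lower_transition_rate_operator Q).
Implicit Types (f g : {ffun X -> R}) (x : X) (a b s t : R).

(** The equation is autonomous, so a solution may be restarted at time [a]. *)
Lemma rate_ode_shift g (u : R -> {ffun X -> R}) a : 0 <= a ->
  solves_rate_ode Q g u -> solves_rate_ode Q (u a) (fun t => u (a + t)).
Proof.
move=> a0 [_ uQ]; split=> [|t t0]; first by rewrite addr0.
have at0 : 0 <= a + t by rewrite addr_ge0.
have /cvgrPdist_le uat := uQ _ at0.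
apply/cvgrPdist_le => e e0; have := uat e e0.
rewrite !near_withinE; apply: filterS => h /= uh h0 th.
by rewrite addrA; apply: (uh h0); rewrite -addrA addr_ge0.
Qed.

Section Solution.
Context (g : {ffun X -> R}) (u : R -> {ffun X -> R}).
Context (uQ : solves_rate_ode Q g u).

Lemma rate_ode_quotient t e : 0 <= t -> 0 < e ->
  \forall h \near (0 : R)^', 0 <= t + h ->
    forall x, `|Q (u t) x - h^-1 * (u (t + h) x - u t x)| <= e.
Proof.
move=> t0 e0; have [_ /(_ t t0) /cvgrPdist_le /(_ e e0)] := uQ.
rewrite near_withinE; apply: filterS => h + th x => /(_ th).
rewrite sub0r normrN => he; rewrite distrC.
have := le_trans (ler_norm _) he; apply: le_trans.
by apply: le_trans (fnorm_ge _ x); rewrite !(scale_ffunEr, ffunE).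
Qed.

Lemma rate_ode_is_derive x t : 0 < t ->
  is_derive t 1 (fun s => u s x) (Q (u t) x).
Proof.
move=> t0.
have ut : h^-1 *: (u (h *: 1 + t) x - u t x) @[h --> (0 : R)^'] -->
    Q (u t) x.
  apply/cvgrPdist_le => e e0.
  have := rate_ode_quotient (ltW t0) e0; apply: filter_app.
  (* For [|h| <= t] the constraint [0 <= t + h] holds, so the restricted limit is a two-sided
     one. *)
  near=> h => /(_ _ x); rewrite [h *: 1]mulr1 (addrC h); apply.
  rewrite -lerBlDl sub0r lerNl.
  apply: le_trans (ler_norm _) _; rewrite normrN; near: h.
  exact/dnbhs0_le.
by apply: DeriveDef; [apply/cvg_ex; exists (Q (u t) x) | exact: cvg_lim].
Unshelve. all: by end_near. Qed.

Lemma rate_ode_continuous x a b : 0 <= a < b ->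
  {within `[a, b], continuous (fun s => u s x)}.
Proof.
move=> /andP[a0 ab].
have c s : 0 < s -> {for s, continuous (fun s => u s x)}.
  move=> s0; apply/differentiable_continuous/derivable1_diffP.
  by have [] := rate_ode_is_derive x s0.
apply/continuous_within_itvP => //; split.
- move=> s; rewrite in_itv /= => /andP[as_ _]; apply: c.
  exact: le_lt_trans as_.
- apply/cvgrPdist_le => e e0.
  have /nbhs_ballP[d /= d0 ud] := rate_ode_quotient a0 ltr01.
  (* The left endpoint may be 0, where no two-sided derivative is available. There the difference
     quotients are within 1 of [Q (u a) x], so [l] is a local Lipschitz constant. *)
  pose l := `|Q (u a) x| + 1; have l0 : 0 < l by rewrite ltr_wpDl.
  near=> s.
  have as_ : a < s by near: s; exact: nbhs_right_gt.
  have sd : s < a + d by near: s; apply: nbhs_right_lt; rewrite ltrDl.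
  have se : s < a + e / l.
    by near: s; apply: nbhs_right_lt; rewrite ltrDl divr_gt0.
  have sa0 : 0 < s - a by rewrite subr_gt0.
  have := ud (s - a) _ _ _ x.
  rewrite subrKC /ball /= sub0r normrN (gtr0_norm sa0).
  rewrite ltrBlDl sd gt_eqF // (le_trans a0 (ltW as_)) => /(_ isT isT isT) qle.
  have {}qle : `|(s - a)^-1 * (u s x - u a x)| <= l.
    rewrite -(normrN (_ * _)) -[X in `|X|](addKr (Q (u a) x)).
    by rewrite (le_trans (ler_normD _ _)) // normrN lerD2l.
  rewrite distrC; move: qle; rewrite normrM normfV (gtr0_norm sa0) mulrC.
  rewrite ler_pdivrMr // => /le_trans; apply.
  by rewrite mulrC -ler_pdivlMr // lerBlDl ltW.
- exact/cvg_at_left_filter/c/(le_lt_trans a0).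
Unshelve. all: by end_near. Qed.

(** The intermediate time depends on the coordinate [x], so the norm estimates built on it are made
    coordinate by coordinate. *)
Lemma rate_ode_MVT x a b : 0 <= a < b ->
  exists2 s, a < s < b & u b x - u a x = Q (u s) x * (b - a).
Proof.
move=> /[dup] /andP[a0 ab] ab0.
have du s : s \in `]a, b[%R -> is_derive s 1 (fun r => u r x) (Q (u s) x).
  rewrite in_itv /= => /andP[as_ _]; apply: rate_ode_is_derive.
  exact: le_lt_trans as_.
have [s sab ->] := MVT ab du (rate_ode_continuous (x := x) ab0).
by exists s.
Qed.

Lemma rate_ode_increment a b C : 0 <= a <= b ->
  (forall s, a <= s <= b -> fnorm_c (u s) <= C) ->
  fnorm (u b - u a) <= (b - a) * (opnorm Q * C).
Proof.
move=> /andP[a0]; rewrite le_eqVlt => /predU1P[-> _|ab uC].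
  by rewrite !subrr mul0r (fnorm0 x0).
apply: (fnorm_le x0) => x; rewrite !ffunE.
have [|s /andP[as_ sb] ->] := rate_ode_MVT x (a := a) (b := b).
  by rewrite a0.
have ba0 : 0 <= b - a by rewrite subr_ge0 ltW.
rewrite normrM mulrC (ger0_norm ba0) ler_wpM2l //.
apply: le_trans (fnorm_ge _ _) _; apply: le_trans (ltro_bounded_c x0 Qr _) _.
by rewrite ler_wpM2l ?(opnorm_ge0 x0 Qr) // uC // !ltW.
Qed.

Lemma rate_ode_euler_step a b C : 0 <= a <= b ->
  (forall s, a <= s <= b -> fnorm_c (u s) <= C) ->
  fnorm (u b - euler_step Q (b - a) (u a)) <=
    (b - a) ^+ 2 * opnorm Q ^+ 2 * C.
Proof.
move=> /andP[a0]; rewrite le_eqVlt => /predU1P[-> _|ab uC].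
  by rewrite /euler_step subrr scale0r addr0 subrr (fnorm0 x0) expr0n !mul0r.
apply: (fnorm_le x0) => x; rewrite !(scale_ffunEr, ffunE).
have [|s /andP[as_ sb] us] := rate_ode_MVT x (a := a) (b := b).
  by rewrite a0.
have ba0 : 0 <= b - a by rewrite subr_ge0 ltW.
have q0 := opnorm_ge0 x0 Qr.
have C0 : 0 <= C.
  by apply: le_trans (fnorm_c_ge0 x0 _) (uC a _); rewrite lexx ltW.
(* The error is now [(b - a) * (Q (u s) x - Q (u a) x)]: one factor [b - a] is explicit, the other
   comes from the Lipschitz bound and the increment of [u] on [a, s]. *)
rewrite opprD addrA us mulrC -mulrBr normrM (ger0_norm ba0).
have := le_trans (fnorm_ge _ x) (ltro_lipschitz x0 Qr (u s) (u a)).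
rewrite !ffunE => QL.
have := rate_ode_increment (a := a) (b := s) (C := C).
rewrite a0 (ltW as_) => /(_ isT) sa.
have {}sa : fnorm (u s - u a) <= (s - a) * (opnorm Q * C).
  by apply: sa => r /andP[ar rs]; apply: uC; rewrite ar (le_trans rs) ?ltW.
rewrite [leRHS](_ : _ = (b - a) * (opnorm Q * ((b - a) * (opnorm Q * C))));
  last by ring.
rewrite ler_wpM2l //; apply: le_trans QL _; rewrite ler_wpM2l //.
by apply: le_trans sa _; rewrite ler_wpM2r ?mulr_ge0 // lerD2r ltW.
Qed.

Lemma rate_ode_bounded b : 0 <= b ->
  exists2 C, 0 <= C & forall s, 0 <= s <= b -> fnorm_c (u s) <= C.
Proof.
rewrite le_eqVlt => /predU1P[<-|b0].
  exists (fnorm_c (u 0)) => [|s s0]; first exact: fnorm_c_ge0.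
  by have <- : 0 = s by apply/eqP; rewrite eq_le.
have /choice[C uC] x : exists C, forall s, 0 <= s <= b -> `|u s x| <= C.
  have b00 : 0 <= (0 : R) < b by rewrite lexx.
  have cu := rate_ode_continuous (x := x) b00.
  have [M _ uM] := EVT_max (ltW b0) cu; have [m _ um] := EVT_min (ltW b0) cu.
  exists (`|u M x| + `|u m x|) => s sb.
  have := uM s; have := um s; rewrite in_itv /= => /(_ sb) + /(_ sb).
  rewrite ler_norml; have := ler_norm (u M x); have := ler_norm (- u m x).
  rewrite normrN; have := normr_ge0 (u M x); have := normr_ge0 (u m x); lra.
have C0 x : 0 <= C x.
  by apply: le_trans (uC x 0 _); rewrite ?normr_ge0 // lexx ltW.
exists (\sum_x C x) => [|s sb]; first exact: sumr_ge0.
apply: le_trans (fnorm_c_le_fnorm x0 _) _; apply: (fnorm_le x0) => x.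
by apply: le_trans (uC x s sb) _; rewrite (bigD1 x) //= lerDl sumr_ge0.
Qed.

(** Each of the [n] steps of length [t / n] adds an error of order [(t / n)^2], and later
    nonexpansive steps do not amplify it. *)
Lemma Psi_error t n C : 0 <= t -> (0 < n)%N -> t * opnorm Q <= 2 * n%:R ->
  (forall s, 0 <= s <= t -> fnorm_c (u s) <= C) ->
  fnorm (u t - Psi Q t n g) <= t ^+ 2 * opnorm Q ^+ 2 * C / n%:R.
Proof.
move=> t0 n0 tn uC; pose d := t / n%:R.
have nR : 0 < n%:R :> R by rewrite ltr0n.
have d0 : 0 <= d by rewrite divr_ge0.
have Et : lower_transition_operator (euler_step Q d).
  by apply: euler_step_lto => //; rewrite /d mulrAC ler_pdivrMr.
have step i : (i <= n)%N -> fnorm (u (i%:R * d) - iter i (euler_step Q d) g) <=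
    i%:R * (d ^+ 2 * opnorm Q ^+ 2 * C).
  elim: i => [_|i IHi i_n].
    by rewrite !mul0r; have [-> _] := uQ; rewrite /= subrr (fnorm0 x0).
  have id0 : 0 <= i%:R * d by rewrite mulr_ge0.
  have le : i%:R * d <= i.+1%:R * d by rewrite ler_wpM2r // ler_nat.
  have dE : i.+1%:R * d - i%:R * d = d.
    by rewrite -mulrBl -natrB // subSnn mul1r.
  have := rate_ode_euler_step (a := i%:R * d) (b := i.+1%:R * d) (C := C).
  rewrite id0 le dE => /(_ isT) eul.
  rewrite -(subrKA (euler_step Q d (u (i%:R * d)))).
  apply: le_trans (fnormD x0 _ _) _; rewrite [leRHS](_ : _ =
    d ^+ 2 * opnorm Q ^+ 2 * C + i%:R * (d ^+ 2 * opnorm Q ^+ 2 * C));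
    last by rewrite -natr1; ring.
  rewrite lerD //.
    apply: eul => s /andP[is_ si]; apply: uC; rewrite (le_trans id0) //=.
    apply: le_trans si _; rewrite -[leRHS](divfK (lt0r_neq0 nR)) mulrC.
    by rewrite ler_wpM2l // ler_nat.
  by apply: le_trans (lto_nonexpansive x0 _ _ Et) _; apply: IHi; exact: ltnW.
have := step n (leqnn n); rewrite /Psi -/d mulrCA divff ?lt0r_neq0 // mulr1.
move=> /le_trans; apply; rewrite le_eqVlt /d; apply/orP; left; apply/eqP.
by field; exact: lt0r_neq0.
Qed.

Lemma Psi_cvg t x : 0 <= t -> Psi Q t n g x @[n --> \oo] --> u t x.
Proof.
move=> t0; have [C C0 uC] := rate_ode_bounded t0.
apply/cvgrPdist_le => e e0; near=> n.
have n0 : (0 < n)%N by near: n; exists 1%N.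
have nR : 0 < n%:R :> R by rewrite ltr0n.
have := Psi_error t0 n0 _ uC => /(_ _) err.
have {}err : fnorm (u t - Psi Q t n g) <= t ^+ 2 * opnorm Q ^+ 2 * C / n%:R.
  by apply: err; rewrite -ler_pdivrMl //; near: n; exact: nbhs_infty_ger.
have := le_trans (fnorm_ge _ x) err; rewrite !ffunE => /le_trans; apply.
rewrite ler_pdivrMr // -ler_pdivrMl //; near: n; exact: nbhs_infty_ger.
Unshelve. all: by end_near. Qed.

End Solution.

(** Both solutions are the limit of the same Euler scheme, which depends only on [g]. *)
Lemma rate_ode_unique g (u v : R -> {ffun X -> R}) t : 0 <= t ->
  solves_rate_ode Q g u -> solves_rate_ode Q g v -> u t = v t.
Proof.
move=> t0 uQ vQ; apply/ffunP => x.
exact: (cvg_unique (@Rhausdorff R) (Psi_cvg uQ t0) (Psi_cvg vQ t0)).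
Qed.

(** * The semigroup generated by the rate operator *)

Section Semigroup.
Context (T : R -> {ffun X -> R} -> {ffun X -> R}).
Context (T_sol : forall g, solves_rate_ode Q g (fun t => T t g)).

Lemma semigroupD a b f : 0 <= a -> 0 <= b -> T (a + b) f = T b (T a f).
Proof.
move=> a0 b0.
exact: rate_ode_unique b0 (rate_ode_shift a0 (T_sol f)) (T_sol (T a f)).
Qed.

Lemma semigroup_iter n d f : 0 <= d -> T (n%:R * d) f = iter n (T d) f.
Proof.
move=> d0; elim: n => [|n IHn]; first by rewrite mul0r; case: (T_sol f).
by rewrite -natr1 mulrDl mul1r semigroupD ?mulr_ge0 // IHn.
Qed.

(** The defining relations pass to pointwise limits, and [Psi Q t n] satisfies them once [n] is
    large. *)
Lemma semigroup_lto t : 0 <= t -> lower_transition_operator (T t).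
Proof.
move=> t0.
have Pt : \forall n \near \oo, lower_transition_operator (Psi Q t n).
  near=> n; apply: lto_iter => //.
  have n0 : (0 < n)%N by near: n; exists 1%N.
  have nR : 0 < n%:R :> R by rewrite ltr0n.
  apply: euler_step_lto; rewrite ?divr_ge0 // mulrAC ler_pdivrMr //.
  by rewrite -ler_pdivrMl //; near: n; exact: nbhs_infty_ger.
have cv f x : Psi Q t n f x @[n --> \oo] --> T t f x :=
  Psi_cvg (T_sol f) t0.
split=> [f x|f g x|mu f mu0].
- apply: (cvgr_to_ge (cv f x)); apply: filterS Pt => n Pn; exact: lto_min.
- apply: (ler_cvg_to (cvgD (cv f x) (cv g x)) (cv (f + g) x)).
  apply: filterS Pt => n Pn; exact: lto_superadd.
- apply/ffunP => x; rewrite scale_ffunEr.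
  apply: (cvg_unique (@Rhausdorff R) (cv (mu *: f) x)).
  apply: cvg_trans (cvgM (cvg_cst mu) (cv f x)).
  apply: near_eq_cvg; apply: filterS Pt => n Pn.
  by rewrite lto_homog // scale_ffunEr.
Unshelve. all: by end_near. Qed.

(** Now that [T s] is known not to increase [fnorm_c], the crude bound [C] can be replaced by
    [fnorm_c f]. *)
Lemma semigroup_euler_step d f : 0 <= d ->
  fnorm (T d f - euler_step Q d f) <= d ^+ 2 * opnorm Q ^+ 2 * fnorm_c f.
Proof.
move=> d0; have [T0 _] := T_sol f.
have := rate_ode_euler_step (T_sol f) (a := 0) (b := d) (C := fnorm_c f).
rewrite lexx d0 subr0 T0; apply=> // s /andP[s0 _].
by rewrite ler_pM2r ?invr_gt0 // lto_fnorm_v //; exact: semigroup_lto.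
Qed.

End Semigroup.
End RateEquation.

Theorem proposition9 (R : realType) (X : finType) (X_neq0 : (0 < #|X|)%N)
    (Q : {ffun X -> R} -> {ffun X -> R})
    (Q_ltro : lower_transition_rate_operator Q)
    (T : R -> {ffun X -> R} -> {ffun X -> R})
    (T_sol : forall g : {ffun X -> R}, solves_rate_ode Q g (fun t => T t g))
    (f : {ffun X -> R}) (m n : nat) (m_gt0 : (0 < m)%N) (n_gt0 : (0 < n)%N)
    (delta : R) (delta_gt0 : 0 < delta) (deltaQ_lt2 : delta * opnorm Q < 2) :
  let t : R := n%:R * delta in
  let k : int := Num.ceil (n%:R / m%:R : R) in
  let bounds (beta : R) : Prop :=
    let eps_e : R := m%:R * delta ^+ 2 * opnorm Q ^+ 2 * fnorm_c f *
                     ((1 - beta ^ k) / (1 - beta)) in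
    let eps_d : R := m%:R * delta ^+ 2 * opnorm Q ^+ 2 * fnorm_c f /
                     (1 - beta) in
    fnorm (T t f - Psi Q t n f) <= eps_e /\ eps_e <= eps_d in
  (let beta : R := ergodicity_coef (iter m (euler_step Q delta)) in
   beta < 1 -> bounds beta) /\
  (let beta : R := ergodicity_coef (T (m%:R * delta)) in
   beta < 1 -> bounds beta).
Proof.
have /card_gt0P[x0 _] := X_neq0.
move=> t k bounds; have d0 := ltW delta_gt0.
have mR : 0 < m%:R :> R by rewrite ltr0n.
have [K kE nKm] : exists2 K : nat, k = K & (n <= K * m)%N.
  have /gez0_abs kE : 0 <= k.
    (* A ceiling is nonnegative as soon as its argument exceeds -1; hence [b ^ k] is a power with
       natural exponent [K]. *)
    by rewrite ceil_ge0 (lt_le_trans (ltrN10 R)) ?divr_ge0.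
  exists `|k|%N => //; rewrite -(ler_nat R) natrM -ler_pdivrMr //.
  by have := ceil_ge (n%:R / m%:R : R); rewrite -/k -kE.
have Et : lower_transition_operator (euler_step Q delta) :=
  euler_step_lto x0 Q_ltro d0 (ltW deltaQ_lt2).
have Tt : lower_transition_operator (T delta) :=
  semigroup_lto x0 Q_ltro T_sol d0.
have TE g := semigroup_euler_step x0 Q_ltro T_sol g d0.
have ET g : fnorm (euler_step Q delta g - T delta g) <=
    delta ^+ 2 * opnorm Q ^+ 2 * fnorm_c g by rewrite -fnormN opprB.
have e0 : 0 <= delta ^+ 2 * opnorm Q ^+ 2 by rewrite mulr_ge0 ?sqr_ge0.
have Titer i g : T (i%:R * delta) g = iter i (T delta) g :=
  semigroup_iter x0 Q_ltro T_sol i g d0.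
have PsiE : Psi Q t n = iter n (euler_step Q delta).
  by rewrite /Psi /t mulrAC divff ?mul1r // pnatr_eq0 -lt0n.
have le_eps b : 0 <= b -> b < 1 ->
    m%:R * delta ^+ 2 * opnorm Q ^+ 2 * fnorm_c f * ((1 - b ^ k) / (1 - b)) <=
    m%:R * delta ^+ 2 * opnorm Q ^+ 2 * fnorm_c f / (1 - b).
  move=> b0 b1; rewrite kE ler_wpM2l //.
    by rewrite -[m%:R * _ * _]mulrA mulr_ge0 ?(fnorm_c_ge0 x0) // mulr_ge0.
  have b1_gt0 : 0 < 1 - b by rewrite subr_gt0.
  by rewrite ler_pdivrMr // mulVf ?lt0r_neq0 // gerBl exprn_ge0.
split=> b b1; split.
- by rewrite Titer PsiE kE -[m%:R * _ * _]mulrA; exact: (iter_error x0).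
- by apply: le_eps => //; exact: ergodicity_coef_ge0 (lto_iter x0 m Et).
(* By the semigroup property [T (m * delta)] is the [m]-th iterate of [T delta], which now plays the
   role of [B]. *)
- have bE : b = ergodicity_coef (iter m (T delta)).
    by congr ergodicity_coef; apply/funext => g; exact: Titer.
  rewrite Titer PsiE kE -[m%:R * _ * _]mulrA -fnormN opprB.
  by rewrite bE; apply: (iter_error x0) => //; rewrite -bE.
- apply: le_eps => //; apply: (ergodicity_coef_ge0 x0).
  by apply: (semigroup_lto x0 Q_ltro T_sol); rewrite mulr_ge0.
Qed.
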